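(* Let $(D,\prec,\succ)$ be a dendriform algebra, let $(V;\prec_l,\succ_l,\prec_r,\succ_r)$ be a representation of it, and let $T:V\to D$ be a relative averaging operator on $(D,\prec,\succ)$ with respect to this representation. Then $V$ is a quadri-dendriform algebra with the operations $$u\prec_\vdash^T v=Tu\prec_l v,\quad u\prec_\dashv^T v=u\prec_r Tv,\quad u\succ_\vdash^T v=Tu\succ_l v,\quad u\succ_\dashv^T v=u\succ_r Tv\qquad(u,v\in V).$$ Moreover, $T$ is a homomorphism from the quadri-dendriform algebra $(V,\prec_\vdash^T,\prec_\dashv^T,\succ_\vdash^T,\succ_\dashv^T)$ to the dendriform algebra $(D,\prec,\succ)$ (the latter regarded as a quadri-dendriform algebra).
   Context: Throughout, $\mathbb{K}$ is a field of characteristic zero; all vector spaces and (multi)linear maps are over $\mathbb{K}$, and all binary operations are bilinear. A dendriform algebra is a vector space $D$ with binary operations $\prec,\succ:D\otimes D\to D$ such that for all $x,y,z\in D$: $(x\prec y)\prec z=x\prec(y\prec z+y\succ z)$, $(x\succ y)\prec z=x\succ(y\prec z)$, $x\succ(y\succ z)=(x\prec y+x\succ y)\succ z$. A representation of $(D,\prec,\succ)$ is a vector space $V$ with bilinear maps $\prec_l,\succ_l:D\otimes V\to V$ and $\prec_r,\succ_r:V\otimes D\to V$ such that for all $x,y,z\in D$, $u\in V$: $(x\prec y)\prec_l u=x\prec_l(y\prec_l u+y\succ_l u)$, $(x\succ y)\prec_l u=x\succ_l(y\prec_l u)$, $x\succ_l(y\succ_l u)=(x\prec y+x\succ y)\succ_l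 u$, $(x\prec_l u)\prec_r z=x\prec_l(u\prec_r z+u\succ_r z)$, $(x\succ_l u)\prec_r z=x\succ_l(u\prec_r z)$, $x\succ_l(u\succ_r z)=(x\prec_l u+x\succ_l u)\succ_r z$, $(u\prec_r y)\prec_r z=u\prec_r(y\prec z+y\succ z)$, $(u\succ_r y)\prec_r z=u\succ_r(y\prec z)$, $u\succ_r(y\succ z)=(u\prec_r y+u\succ_r y)\succ_r z$. A relative averaging operator on $D$ with respect to $(V;\prec_l,\succ_l,\prec_r,\succ_r)$ is a linear map $T:V\to D$ with $Tu\prec Tv=T(Tu\prec_l v)=T(u\prec_r Tv)$ and $Tu\succ Tv=T(Tu\succ_l v)=T(u\succ_r Tv)$ for all $u,v\in V$. A quadri-dendriform algebra is a vector space $\mathcal{D}$ with four binary operations $\prec_\vdash,\prec_\dashv,\succ_\vdash,\succ_\dashv$ such that for all $x,y,z\in\mathcal{D}$: (1) $(x\prec_\vdash y)\prec_\vdash z=(x\prec_\dashv y)\prec_\vdash z=x\prec_\vdash(y\prec_\vdash z+y\succ_\vdash z)$; (2) $(x\succ_\vdash y)\prec_\vdash z=(x\succ_\dashv y)\prec_\vdash z=x\succ_\vdash(y\prec_\vdash z)$; (3) $x\succ_\vdash(y\succ_\vdash z)=(x\prec_\vdash y+x\succ_\vdash y)\succ_\vdash z=(x\prec_\dashv y+x\succ_\dashv y)\succ_\vdash z=(x\prec_\vdash y+x\succ_\dashv y)\succ_\vdash z=(x\prec_\dashv y+x\succ_\vdash y)\succ_\vdash z$; (4) $(x\prec_\vdash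 y)\prec_\dashv z=x\prec_\vdash(y\prec_\dashv z+y\succ_\dashv z)$; (5) $(x\succ_\vdash y)\prec_\dashv z=x\succ_\vdash(y\prec_\dashv z)$; (6) $x\succ_\vdash(y\succ_\dashv z)=(x\prec_\vdash y+x\succ_\vdash y)\succ_\dashv z$; (7) $(x\prec_\dashv y)\prec_\dashv z=x\prec_\dashv(y\prec_\vdash z+y\succ_\vdash z)=x\prec_\dashv(y\prec_\dashv z+y\succ_\dashv z)=x\prec_\dashv(y\prec_\vdash z+y\succ_\dashv z)=x\prec_\dashv(y\prec_\dashv z+y\succ_\vdash z)$; (8) $(x\succ_\dashv y)\prec_\dashv z=x\succ_\dashv(y\prec_\vdash z)=x\succ_\dashv(y\prec_\dashv z)$; (9) $x\succ_\dashv(y\succ_\vdash z)=x\succ_\dashv(y\succ_\dashv z)=(x\prec_\dashv y+x\succ_\dashv y)\succ_\dashv z$. A morphism (homomorphism) of quadri-dendriform algebras is a linear map compatible with the four operations. A dendriform algebra $(D,\prec,\succ)$ is regarded as a quadri-dendriform algebra by setting $\prec_\vdash=\prec_\dashv=\prec$ and $\succ_\vdash=\succ_\dashv=\succ$. *)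

(* Defs.v *)
From mathcomp Require Import all_boot all_algebra.

Set Implicit Arguments.
Unset Strict Implicit.
Unset Printing Implicit Defensive.

Import GRing.Theory.
Local Open Scope ring_scope.

Local Notation is_bilinear f := (bilinear_for *:%R *:%R f).

Section Dendriform.
Variables (K : fieldType) (D : lmodType K) (prec succ : D -> D -> D).

Local Notation "x ≺ y" := (prec x y) (at level 40, no associativity).
Local Notation "x ≻ y" := (succ x y) (at level 40, no associativity).

Record is_dendriform : Prop := IsDendriform {
  dend_prec_bilinear : is_bilinear prec;
  dend_succ_bilinear : is_bilinear succ;
  dend_prec_prec : forall x y z, (x ≺ y) ≺ z = x ≺ (y ≺ z + y ≻ z);
  dend_succ_prec : forall x y z, (x ≻ y) ≺ z = x ≻ (y ≺ z);
  dend_succ_succ : forall x y z, x ≻ (y ≻ z) = (x ≺ y + x ≻ y) ≻ z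
}.

Variables (V : lmodType K) (precl succl : D -> V -> V)
  (precr succr : V -> D -> V).

Local Notation "x ≺l u" := (precl x u) (at level 40, no associativity).
Local Notation "x ≻l u" := (succl x u) (at level 40, no associativity).
Local Notation "u ≺r x" := (precr u x) (at level 40, no associativity).
Local Notation "u ≻r x" := (succr u x) (at level 40, no associativity).

Record is_representation : Prop := IsRepresentation {
  rep_precl_bilinear : is_bilinear precl;
  rep_succl_bilinear : is_bilinear succl;
  rep_precr_bilinear : is_bilinear precr;
  rep_succr_bilinear : is_bilinear succr;

  rep_prec_precl : forall x y u, (x ≺ y) ≺l u = x ≺l (y ≺l u + y ≻l u);
  rep_succ_precl : forall x y u, (x ≻ y) ≺l u = x ≻l (y ≺l u);
  rep_succl_succl : forall x y u, x ≻l (y ≻l u) = (x ≺ y + x ≻ y) ≻l u;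

  rep_precl_precr : forall x u z, (x ≺l u) ≺r z = x ≺l (u ≺r z + u ≻r z);
  rep_succl_precr : forall x u z, (x ≻l u) ≺r z = x ≻l (u ≺r z);
  rep_succl_succr : forall x u z, x ≻l (u ≻r z) = (x ≺l u + x ≻l u) ≻r z;

  rep_precr_precr : forall u y z, (u ≺r y) ≺r z = u ≺r (y ≺ z + y ≻ z);
  rep_succr_precr : forall u y z, (u ≻r y) ≺r z = u ≻r (y ≺ z);
  rep_succr_succr : forall u y z, u ≻r (y ≻ z) = (u ≺r y + u ≻r y) ≻r z
}.

Record is_relative_averaging (T : V -> D) : Prop := IsRelativeAveraging {
  ravg_linear : linear T;
  ravg_precl : forall u v, T u ≺ T v = T (T u ≺l v);
  ravg_precr : forall u v, T (T u ≺l v) = T (u ≺r T v);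
  ravg_succl : forall u v, T u ≻ T v = T (T u ≻l v);
  ravg_succr : forall u v, T (T u ≻l v) = T (u ≻r T v)
}.

End Dendriform.

(* The suffixes [_v] and [_d] stand for the subscripts ⊢ (\vdash) and
   ⊣ (\dashv). *)
Record quadri_ops (A : Type) := QuadriOps {
  prec_v : A -> A -> A;
  prec_d : A -> A -> A;
  succ_v : A -> A -> A;
  succ_d : A -> A -> A
}.

Section QuadriDendriform.
Variables (K : fieldType) (A : lmodType K) (Q : quadri_ops A).

Local Notation "x ≺⊢ y" := (prec_v Q x y) (at level 40, no associativity).
Local Notation "x ≺⊣ y" := (prec_d Q x y) (at level 40, no associativity).
Local Notation "x ≻⊢ y" := (succ_v Q x y) (at level 40, no associativity).
Local Notation "x ≻⊣ y" := (succ_d Q x y) (at level 40, no associativity).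

(* A chain of equalities a = b = c = ... is written [a = b /\ a = c /\ ...]. *)
Record is_quadri_dendriform : Prop := IsQuadriDendriform {
  qd_prec_v_bilinear : is_bilinear (prec_v Q);
  qd_prec_d_bilinear : is_bilinear (prec_d Q);
  qd_succ_v_bilinear : is_bilinear (succ_v Q);
  qd_succ_d_bilinear : is_bilinear (succ_d Q);

  qd_axiom1 : forall x y z,
    (x ≺⊢ y) ≺⊢ z = (x ≺⊣ y) ≺⊢ z /\
    (x ≺⊢ y) ≺⊢ z = x ≺⊢ (y ≺⊢ z + y ≻⊢ z);
  qd_axiom2 : forall x y z,
    (x ≻⊢ y) ≺⊢ z = (x ≻⊣ y) ≺⊢ z /\
    (x ≻⊢ y) ≺⊢ z = x ≻⊢ (y ≺⊢ z);
  qd_axiom3 : forall x y z,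
    x ≻⊢ (y ≻⊢ z) = (x ≺⊢ y + x ≻⊢ y) ≻⊢ z /\
    x ≻⊢ (y ≻⊢ z) = (x ≺⊣ y + x ≻⊣ y) ≻⊢ z /\
    x ≻⊢ (y ≻⊢ z) = (x ≺⊢ y + x ≻⊣ y) ≻⊢ z /\
    x ≻⊢ (y ≻⊢ z) = (x ≺⊣ y + x ≻⊢ y) ≻⊢ z;
  qd_axiom4 : forall x y z,
    (x ≺⊢ y) ≺⊣ z = x ≺⊢ (y ≺⊣ z + y ≻⊣ z);
  qd_axiom5 : forall x y z,
    (x ≻⊢ y) ≺⊣ z = x ≻⊢ (y ≺⊣ z);
  qd_axiom6 : forall x y z,
    x ≻⊢ (y ≻⊣ z) = (x ≺⊢ y + x ≻⊢ y) ≻⊣ z;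
  qd_axiom7 : forall x y z,
    (x ≺⊣ y) ≺⊣ z = x ≺⊣ (y ≺⊢ z + y ≻⊢ z) /\
    (x ≺⊣ y) ≺⊣ z = x ≺⊣ (y ≺⊣ z + y ≻⊣ z) /\
    (x ≺⊣ y) ≺⊣ z = x ≺⊣ (y ≺⊢ z + y ≻⊣ z) /\
    (x ≺⊣ y) ≺⊣ z = x ≺⊣ (y ≺⊣ z + y ≻⊢ z);
  qd_axiom8 : forall x y z,
    (x ≻⊣ y) ≺⊣ z = x ≻⊣ (y ≺⊢ z) /\
    (x ≻⊣ y) ≺⊣ z = x ≻⊣ (y ≺⊣ z);
  qd_axiom9 : forall x y z,
    x ≻⊣ (y ≻⊢ z) = x ≻⊣ (y ≻⊣ z) /\
    x ≻⊣ (y ≻⊢ z) = (x ≺⊣ y + x ≻⊣ y) ≻⊣ z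
}.

End QuadriDendriform.

Record is_quadri_morphism (K : fieldType) (A B : lmodType K)
    (P : quadri_ops A) (Q : quadri_ops B) (f : A -> B) : Prop :=
  IsQuadriMorphism {
    qmor_linear : linear f;
    qmor_prec_v : forall x y, f (prec_v P x y) = prec_v Q (f x) (f y);
    qmor_prec_d : forall x y, f (prec_d P x y) = prec_d Q (f x) (f y);
    qmor_succ_v : forall x y, f (succ_v P x y) = succ_v Q (f x) (f y);
    qmor_succ_d : forall x y, f (succ_d P x y) = succ_d Q (f x) (f y)
  }.

Definition quadri_of_dendriform (D : Type) (prec succ : D -> D -> D)
  : quadri_ops D :=
  QuadriOps prec prec succ succ.

Lemma quadri_of_dendriformP (K : fieldType) (D : lmodType K)
    (prec succ : D -> D -> D) :
  is_dendriform prec succ ->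
  is_quadri_dendriform (quadri_of_dendriform prec succ).
Proof.
case=> bp bs pp sp ss.
by split=> //= x y z; rewrite ?pp ?sp ?ss; do ?split.
Qed.

Definition averaging_quadri_ops (D V : Type)
    (precl succl : D -> V -> V) (precr succr : V -> D -> V) (T : V -> D)
  : quadri_ops V :=
  {| prec_v := fun u v => precl (T u) v;
     prec_d := fun u v => precr u (T v);
     succ_v := fun u v => succl (T u) v;
     succ_d := fun u v => succr u (T v) |}.

(* Main.v *)
Require Import Defs.
From mathcomp Require Import all_boot all_algebra.

(** The identities of a relative averaging operator say that T carries all four
    products on V to the corresponding products of D, whatever the subscript.
    This is already the morphism statement, and the axioms follow from it.  In
    each axiom, the operations ≺⊢ and ≻⊢ see their left argument, and ≺⊣ and
    ≻⊣ their right argument, only through T.  An inner product standing in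
    such a position may therefore be replaced by a product of D, which does
    not remember whether it came from a ⊢ or a ⊣ operation: that is why the
    several expressions in one axiom coincide.  What then remains is one of
    the nine identities of a representation, with two of its three arguments
    in the image of T. *)

Local Open Scope ring_scope.

Import GRing.Theory.

Section LinearSubstitution.
Variables (K : fieldType) (D V : lmodType K) (T : V -> D).
Hypothesis linT : linear T.

Lemma bilinear_compl (f : D -> V -> V) :
  bilinear_for *:%R *:%R f -> bilinear_for *:%R *:%R (fun u v => f (T u) v).
Proof.
case=> linl linr; split=> [v a u u' | u]; last exact: linr.
by rewrite linT linl.
Qed.

Lemma bilinear_compr (f : V -> D -> V) :
  bilinear_for *:%R *:%R f -> bilinear_for *:%R *:%R (fun u v => f u (T v)).
Proof.
case=> linl linr; split=> [v | u a v v']; first exact: linl.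
by rewrite linT linr.
Qed.

End LinearSubstitution.

Section RelativeAveraging.
Variables (K : fieldType) (D V : lmodType K) (prec succ : D -> D -> D).
Variables (precl succl : D -> V -> V) (precr succr : V -> D -> V) (T : V -> D).
Hypothesis avgT : is_relative_averaging prec succ precl succl precr succr T.

Let Q := averaging_quadri_ops precl succl precr succr T.

Lemma averaging_quadri_morphism :
  is_quadri_morphism Q (quadri_of_dendriform prec succ) T.
Proof.
case: avgT => linT Tpl Tpr Tsl Tsr.
by split=> //= u v; rewrite -?Tpr -?Tsr -?Tpl -?Tsl.
Qed.

(** Of the three arguments of an axiom exactly one is not seen through T: the
    last one in axioms 1-3, the middle one in 4-6, the first one in 7-9.  This
    place is the place of the module element in the matching identity of the
    representation.  In the middle case the two sides already agree with that
    identity; otherwise T is first pushed through the inner products. *)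
Lemma averaging_quadri_dendriform :
  is_representation prec succ precl succl precr succr ->
  is_quadri_dendriform Q.
Proof.
case=> bpl bsl bpr bsr lpp lsp lss mpp msp mss rpp rsp rss.
case: averaging_quadri_morphism => linT /= Tpl Tpr Tsl Tsr.
have TD u v : T (u + v) = T u + T v by have := linT 1 u v; rewrite !scale1r.
have TE := (TD, Tpl, Tpr, Tsl, Tsr).
split=> /=; try exact: bilinear_compl; try exact: bilinear_compr;
  move=> u v w; rewrite ?TE.
- by rewrite lpp.
- by rewrite lsp.
- by rewrite lss.
- exact: mpp.
- exact: msp.
- exact: mss.
- by rewrite rpp.
- by rewrite rsp.
- by rewrite rss.
Qed.

End RelativeAveraging.

Theorem proposition2p18 (K : fieldType) (charK0 : has_pchar0 K)
    (D V : lmodType K) (prec succ : D -> D -> D)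
    (precl succl : D -> V -> V) (precr succr : V -> D -> V) (T : V -> D)
    (dendD : is_dendriform prec succ)
    (repV : is_representation prec succ precl succl precr succr)
    (avgT : is_relative_averaging prec succ precl succl precr succr T) :
  is_quadri_dendriform (averaging_quadri_ops precl succl precr succr T) /\
  is_quadri_morphism (averaging_quadri_ops precl succl precr succr T)
    (quadri_of_dendriform prec succ) T.
Proof.
split; last exact: averaging_quadri_morphism.
exact: averaging_quadri_dendriform avgT repV.
Qed.
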